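(* Let $\alpha\ge\aleph_0$ be a cardinal number, $I=[0,\infty)$, and let $w$ be a weight function on $I$. Let $\varphi$ and $\varphi_n$ ($n\ge1$) be Orlicz functions such that each $\varphi_n$ satisfies the $\Delta_\varphi(0)$-condition and $\varphi_{n+1}\prec\varphi_n$ for every $n\in\mathbb{N}$. Then: (i) If $\alpha\le\mathfrak{c}$ or $\alpha>\mathrm{card}((\Lambda_{\varphi,w})_a)$, then $(\Lambda_{\varphi,w})_a\setminus\bigcup_{n=1}^\infty\Lambda_{\varphi_n,w}$ is not $(\alpha,\beta)$-spaceable in $(\Lambda_{\varphi,w})_a$, for any cardinal number $\beta\ge\alpha$. (ii) If $\varphi$ satisfies the $\Delta_2$-condition, then $\Lambda_{\varphi,w}\setminus\bigcup_{n=1}^\infty\Lambda_{\varphi_n,w}$ is not $(\alpha,\beta)$-spaceable in $\Lambda_{\varphi,w}$, for any cardinal number $\beta\ge\alpha$.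
   Context: The interval $I=[0,\infty)$ carries Lebesgue measure $m$. $L_0$ is the space of real Lebesgue measurable functions on $I$ modulo a.e. equality. For $f\in L_0$, $d_f(\lambda)=m(\{t\in I:|f(t)|>\lambda\})$ for $\lambda>0$, and $f^*(t)=\inf\{\lambda>0:d_f(\lambda)\le t\}$ for $t\ge 0$ (with $\inf\varnothing=\infty$). An Orlicz function is a convex function $\varphi:[0,\infty)\to[0,\infty)$ with $\varphi(0)=0=\lim_{u\to0}\varphi(u)$ and $\varphi(u)>0$ for $u>0$ (put $\varphi(\infty)=\infty$). It satisfies the $\Delta_2^\infty$-condition if there are $K>2$, $u_0\ge0$ with $\varphi(2u)\le K\varphi(u)$ for all $u\ge u_0$; the $\Delta_2^0$-condition if there are $K>2$, $u_0>0$ with $\varphi(2u)\le K\varphi(u)$ for all $0\le u\le u_0$; the $\Delta_2$-condition if it satisfies both. An Orlicz function $\psi$ satisfies the $\Delta_\varphi(0)$-condition if for every $b>0$ there exists $u_0>0$ such that $\varphi(u)\le\psi(bu)$ for every $0\le u\le u_0$. Write $\varphi\prec\psi$ if there is $b>0$ with $\varphi(u)\le\psi(bu)$ for all $u\ge0$. A weight function on $I$ is a positive, decreasing (i.e. nonincreasing) function $w:(0,\infty)\to(0,\infty)$ with $\int_0^t w<\infty$ for every $t>0$ and $\int_0^\infty w=\infty$. The modular is $\rho_{\varphi,w}(f)=\int_I\varphi(f^*(t))w(t)\,dt$. The Orlicz-Lorentz space is $\Lambda_{\varphi,w}=\{f\in L_0:\rho_{\varphi,w}(kf)<\infty\text{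 for some }k>0\}$ with the Luxemburg norm $\|f\|_{\varphi,w}=\inf\{\varepsilon>0:\rho_{\varphi,w}(f/\varepsilon)\le1\}$ (a Banach space). $(\Lambda_{\varphi,w})_a$ is its closed subspace of order-continuous elements (those $f$ with $\|f_n\|_{\varphi,w}\downarrow0$ whenever $|f_n|\le|f|$ and $|f_n|\downarrow0$ a.e.); it is well known that $(\Lambda_{\varphi,w})_a=\{f\in L_0:\rho_{\varphi,w}(kf)<\infty\text{ for every }k>0\}$. $\mathfrak{c}$ is the cardinality of the continuum. For a subset $A$ of a topological vector space $X$ and cardinals $\alpha\le\beta$: $A$ is $\alpha$-lineable if there is an $\alpha$-dimensional vector subspace $M\subset X$ with $M\subset A\cup\{0\}$; $A$ is $(\alpha,\beta)$-spaceable if $A$ is $\alpha$-lineable and for every $\alpha$-dimensional vector subspace $M_\alpha$ of $X$ with $M_\alpha\subset A\cup\{0\}$ there is a closed $\beta$-dimensional vector subspace $M_\beta$ of $X$ with $M_\alpha\subset M_\beta\subset A\cup\{0\}$. *)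

(* Defs.v *)
From HB Require Import structures.
From mathcomp Require Import all_boot all_order all_algebra.
From mathcomp Require Import all_classical all_reals all_analysis.

Set Implicit Arguments.
Unset Strict Implicit.
Unset Printing Implicit Defensive.

Import Order.TTheory GRing.Theory Num.Theory.
Import numFieldNormedType.Exports.

Local Open Scope classical_set_scope.
Local Open Scope card_scope.
Local Open Scope ring_scope.

(* A cardinal number is represented by a type (equivalently, by the set of all
   its inhabitants); comparison is the library's [#<=], [#=]. *)
Definition card_lt (T U : Type) (A : set T) (B : set U) : Prop :=
  (A #<= B) /\ (A #!= B).

Section linear_algebra.
Context {R : realType} {V : lmodType R}.
Implicit Types (B M X A : set V) (op : set (set V)).

Definition linear_subspace M : Prop := submod_closed (fun v => v \in M).

Definition lin_indep B : Prop :=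
  forall (s : seq V) (c : V -> R), uniq s -> [set` s] `<=` B ->
    \sum_(v <- s) c v *: v = 0 -> forall v, v \in s -> c v = 0.

Definition lin_comb B : set V :=
  [set x | exists (s : seq V) (c : V -> R),
    [set` s] `<=` B /\ x = \sum_(v <- s) c v *: v].

Definition has_dim M (alpha : Type) : Prop :=
  exists B : set V,
    [/\ lin_indep B, lin_comb B = M & B #= [set: alpha]].

Definition lineable_witness X A (alpha : Type) M : Prop :=
  [/\ linear_subspace M, M `<=` X, has_dim M alpha & M `<=` A `|` [set 0]].

(* The topological vector space in which lineability and spaceability are
   considered is given as a vector subspace X of V together with the family op
   of the open subsets of X. *)
Definition lineable X A (alpha : Type) : Prop :=
  exists M, lineable_witness X A alpha M.

Definition spaceable X op A (alpha beta : Type) : Prop :=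
  lineable X A alpha /\
  forall M, lineable_witness X A alpha M ->
    exists M', [/\ linear_subspace M', M' `<=` X, op (X `\` M'),
      has_dim M' beta & M `<=` M' /\ M' `<=` A `|` [set 0]].

Definition norm_open X (N : V -> \bar R) : set (set V) :=
  [set U | U `<=` X /\
    forall f, U f -> exists2 e : R, 0 < e &
      forall g, X g -> (N (g - f)%R < e%:E)%E -> U g].

End linear_algebra.

Section L0.
Context {R : realType}.

(* The real line with the sigma-algebra of Lebesgue measurable sets. *)
Definition lebesgue_line : measurableType _ :=
  caratheodory_type ((wlength (@idfun R)) ^*)%mu.

Definition half_line : set R := `[0, +oo[.

Let completed : {measure set lebesgue_line -> \bar R} :=
  @completed_lebesgue_measure R.

Lemma measurable_half_line : measurable (half_line : set lebesgue_line).
Proof.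
apply: sub_caratheodory.
exact: (measurable_itv `[0%R, +oo[ : @measurable _ (measurableTypeR R) _).
Qed.

(* Lebesgue measure on I = [0, oo), seen as a measure on the whole line that
   vanishes outside I. *)
Definition mI : {measure set lebesgue_line -> \bar R} :=
  mrestr completed measurable_half_line.

(* Functions are defined on the whole line, but identified as soon as they
   agree almost everywhere on I. An element f of L0 coerces to a function,
   namely an arbitrary representative of its class. *)
Definition L0 : Type := {mfun_ mI, lebesgue_line >-> R}.
Identity Coercion L0_aeEqMfun : L0 >-> aeEqMfun.

Local Open Scope quotient_scope.

HB.instance Definition _ := Choice.on L0.
HB.instance Definition _ := EqQuotient.on L0.

Lemma L0_ext (f g : L0) : (\forall t \ae mI, f t = g t) -> f = g.
Proof.
move=> fg; rewrite -[f]reprK -[g]reprK; apply/eqmodP/asboolP.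
by apply: filterS fg => t /= + _.
Qed.

Lemma L0_reprP (f : {mfun lebesgue_line >-> R}) :
  \forall t \ae mI, (\pi_L0 f : L0) t = f t.
Proof.
have : repr (\pi_L0 f) = f %[mod L0] by rewrite reprK.
by move=> /eqmodP/asboolP; apply: filterS => t /= /(_ Logic.I).
Qed.

Let mfunL : lmodType R := {mfun lebesgue_line >-> R}.

Definition L0_zero : L0 := \pi_L0 (0 : mfunL).
Definition L0_opp (f : L0) : L0 := \pi_L0 (- (repr f : mfunL)).
Definition L0_add (f g : L0) : L0 := \pi_L0 ((repr f : mfunL) + repr g).
Definition L0_scale (a : R) (f : L0) : L0 := \pi_L0 (a *: (repr f : mfunL)).

Let zeroE : \forall t \ae mI, L0_zero t = 0. Proof. exact: L0_reprP. Qed.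
Let oppE f : \forall t \ae mI, L0_opp f t = - f t. Proof. exact: L0_reprP. Qed.
Let addE f g : \forall t \ae mI, L0_add f g t = f t + g t.
Proof. exact: L0_reprP. Qed.
Let scaleE a f : \forall t \ae mI, L0_scale a f t = a * f t.
Proof. exact: L0_reprP. Qed.

Lemma L0_addA : associative L0_add.
Proof.
move=> f g h; apply: L0_ext.
apply: filterS2 (filterI (addE f (L0_add g h)) (addE g h))
  (filterI (addE (L0_add f g) h) (addE f g)).
by move=> t [-> ->] [-> ->]; rewrite addrA.
Qed.

Lemma L0_addC : commutative L0_add.
Proof.
move=> f g; apply: L0_ext.
by apply: filterS2 (addE f g) (addE g f) => t -> ->; rewrite addrC.
Qed.

Lemma L0_add0 : left_id L0_zero L0_add.
Proof.
move=> f; apply: L0_ext.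
by apply: filterS2 (addE L0_zero f) zeroE => t -> ->; rewrite add0r.
Qed.

Lemma L0_addN : left_inverse L0_zero L0_opp L0_add.
Proof.
move=> f; apply: L0_ext; move: (addE (L0_opp f) f) (oppE f) zeroE.
by apply: filterS3 => t -> -> ->; rewrite addNr.
Qed.

HB.instance Definition _ :=
  GRing.isZmodule.Build L0 L0_addA L0_addC L0_add0 L0_addN.

Lemma L0_scaleA (a b : R) (f : L0) :
  L0_scale a (L0_scale b f) = L0_scale (a * b) f.
Proof.
apply: L0_ext; move: (scaleE a (L0_scale b f)) (scaleE b f) (scaleE (a * b) f).
by apply: filterS3 => t -> -> ->; rewrite mulrA.
Qed.

Lemma L0_scale1 : left_id 1 L0_scale.
Proof.
move=> f; apply: L0_ext; apply: filterS (scaleE 1 f) => t ->.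
by rewrite mul1r.
Qed.

Lemma L0_scaleDr : right_distributive L0_scale +%R.
Proof.
move=> a f g.
change (L0_scale a (L0_add f g) = L0_add (L0_scale a f) (L0_scale a g)).
apply: L0_ext; apply: filterS2 (filterI (scaleE a (L0_add f g)) (addE f g))
  (filterI (addE (L0_scale a f) (L0_scale a g))
           (filterI (scaleE a f) (scaleE a g))).
move=> t [-> ->] [-> [fE gE]]; rewrite mulrDr.
by congr (_ + _); exact: esym.
Qed.

Lemma L0_scaleDl (f : L0) : {morph L0_scale ^~ f : a b / a + b}.
Proof.
move=> a b.
change (L0_scale (a + b) f = L0_add (L0_scale a f) (L0_scale b f)).
apply: L0_ext; apply: filterS2 (filterI (scaleE (a + b) f) (scaleE a f))
  (filterI (addE (L0_scale a f) (L0_scale b f)) (scaleE b f)).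
move=> t [-> fE] [-> gE]; rewrite mulrDl.
by congr (_ + _); exact: esym.
Qed.

HB.instance Definition _ :=
  GRing.Zmodule_isLmodule.Build R L0 L0_scaleA L0_scale1 L0_scaleDr L0_scaleDl.

Lemma L0_zeroE : \forall t \ae mI, (0 : L0) t = 0.
Proof. exact: zeroE. Qed.

Lemma L0_addE (f g : L0) : \forall t \ae mI, (f + g : L0) t = f t + g t.
Proof. exact: addE. Qed.

Lemma L0_scaleE (a : R) (f : L0) : \forall t \ae mI, (a *: f : L0) t = a * f t.
Proof. exact: scaleE. Qed.

End L0.
Arguments L0 : clear implicits.

Section orlicz_functions.
Context {R : realType}.
Implicit Types (phi psi w : R -> R).

(* An Orlicz function or a weight is a function on R, of which only the values
   on [0, oo), resp. (0, oo), matter. *)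
Definition orlicz_function phi : Prop :=
  [/\ convex_function (E := R^o) half_line phi,
      phi 0 = 0,
      phi u @[u --> 0^'+] --> 0 &
      forall u, 0 < u -> 0 < phi u].

Definition delta2_infty phi : Prop :=
  exists K u0 : R, [/\ 2 < K, 0 <= u0 &
    forall u, u0 <= u -> phi (2 * u) <= K * phi u].

Definition delta2_zero phi : Prop :=
  exists K u0 : R, [/\ 2 < K, 0 < u0 &
    forall u, 0 <= u <= u0 -> phi (2 * u) <= K * phi u].

Definition delta2 phi : Prop := delta2_infty phi /\ delta2_zero phi.

Definition delta_at_zero phi psi : Prop :=
  forall b : R, 0 < b -> exists2 u0 : R, 0 < u0 &
    forall u, 0 <= u <= u0 -> phi u <= psi (b * u).

Definition orlicz_prec phi psi : Prop :=
  exists2 b : R, 0 < b & forall u, 0 <= u -> phi u <= psi (b * u).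

Definition weight_function w : Prop :=
  [/\ forall t, 0 < t -> 0 < w t,
      forall s t, 0 < s -> s <= t -> w t <= w s,
      forall t, 0 < t ->
        (\int[lebesgue_measure]_(s in `]0%R, t[) (w s)%:E < +oo)%E &
      (\int[lebesgue_measure]_(s in `]0%R, +oo[) (w s)%:E = +oo)%E].

Definition ereal_ext phi (x : \bar R) : \bar R :=
  if x is r%:E then (phi r)%:E else +oo%E.

End orlicz_functions.

Section orlicz_lorentz.
Context {R : realType}.
Implicit Types (phi w : R -> R) (f g : L0 R).

Definition distribution_fun f (lambda : R) : \bar R :=
  mI [set t | lambda < `|f t|].

Definition rearrangement f (t : R) : \bar R :=
  ereal_inf [set lambda%:E | lambda in
    [set lambda : R | 0 < lambda /\ (distribution_fun f lambda <= t%:E)%E]].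

Definition modular phi w f : \bar R :=
  (\int[lebesgue_measure]_(t in half_line)
     (ereal_ext phi (rearrangement f t) * (w t)%:E))%E.

Definition orlicz_lorentz phi w : set (L0 R) :=
  [set f | exists2 k : R, 0 < k & (modular phi w (k *: f) < +oo)%E].

(* Extended-valued, so that it does not assign a spurious finite value to the
   functions outside the Orlicz-Lorentz space. *)
Definition luxemburg_norm phi w f : \bar R :=
  ereal_inf [set e%:E | e in
    [set e : R | 0 < e /\ (modular phi w (e^-1 *: f) <= 1)%E]].

Definition order_continuous_part phi w : set (L0 R) :=
  [set f | orlicz_lorentz phi w f /\
    forall u : nat -> L0 R,
      (forall n, \forall t \ae mI, `|u n t| <= `|f t|) ->
      (forall n, \forall t \ae mI, `|u n.+1 t| <= `|u n t|) ->
      (\forall t \ae mI, `|u n t| @[n --> \oo] --> (0 : R)) ->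
      (forall n, (luxemburg_norm phi w (u n.+1) <= luxemburg_norm phi w (u n))%E)
      /\ luxemburg_norm phi w (u n) @[n --> \oo] --> 0%E].

End orlicz_lorentz.

(* Main.v *)
From HB Require Import structures.
Require Import Defs.
From mathcomp Require Import all_boot all_order all_algebra.
From mathcomp Require Import all_classical all_reals all_analysis.
From mathcomp Require Import measurable_realfun ring lra.

(** Write X for the ambient space, that is (Lambda_phi)_a or Lambda_phi, and Y
    for the union of the spaces Lambda_(phi_n). Since phi_(n+1) is dominated by
    a dilation of phi_n, these spaces increase with n, so Y is a vector
    subspace. The theorem is then an instance of a fact about a pair of
    subspaces X and Y with a nonzero common vector g (lemma
    [not_spaceable_setD]): for infinite alpha, X minus Y is never
    (alpha, beta)-spaceable in X.

    The reason is as follows. Spaceability includes lineability, so there is an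
    alpha-dimensional M that meets Y only in 0. Take a basis B of M and tilt
    it: replace each v in B by v + c(v) g. As g is not in M, the tilted family
    is still independent, and a combination m + b g of it lies in Y only if m
    does, that is if m = 0 and the combination is trivial. So the tilted span
    is another alpha-dimensional subspace that meets Y only in 0. Because B is
    infinite, c can be chosen such that the vectors v / c(v) come arbitrarily
    close to 0, and then g is a limit of vectors v / c(v) + g of the tilted
    span. No closed subspace can contain that span and avoid the nonzero
    vector g of Y.

    For g we take the indicator function of [0, 1]. What remains is to check
    that X and Y are vector spaces, that g belongs to both, and that every
    element of X becomes small in norm when scaled. All spaces involved are
    shown to be order ideals of L0, i.e. to contain h as soon as they contain
    f and g and |h| <= C max(|f|, |g|). This rests on one estimate
    (lemma [modular_max]): if |h| <= max(|f|, |g|) then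
    rho(h) <= 2 (rho(f) + rho(g)). It follows from
    h*(2t) <= max(f*(t), g*(t)) and the monotonicity of the weight, and it
    replaces the triangle inequality of the Luxemburg norm throughout. *)

Set Implicit Arguments.
Unset Strict Implicit.
Unset Printing Implicit Defensive.

Import Order.TTheory GRing.Theory Num.Theory.
Import numFieldNormedType.Exports.

Local Open Scope classical_set_scope.
Local Open Scope card_scope.
Local Open Scope ring_scope.

(** * Spans and a criterion against spaceability *)

Section linear_algebra.
Context {R : realType} {V : lmodType R}.
Implicit Types (B M X Y : set V) (g : V) (T : V -> V).

Lemma linear_subspaceP M : linear_subspace M <->
  M 0 /\ forall a u v, M u -> M v -> M (a *: u + v).
Proof.
split=> [[M0 ML]|[M0 ML]].
  split; first by move: M0; rewrite inE.
  by move=> a u v Mu Mv; have := ML a u v; rewrite !inE; apply.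
split; first by rewrite inE.
by move=> a u v; rewrite !inE => Mu Mv; exact: ML.
Qed.

Lemma linear_subspaceB M u v : linear_subspace M -> M u -> M v -> M (u - v).
Proof.
move=> /linear_subspaceP[_ ML] Mu Mv.
by rewrite addrC -scaleN1r; exact: ML.
Qed.

Lemma linear_subspaceZ M a v : linear_subspace M -> M v -> M (a *: v).
Proof.
move=> /linear_subspaceP[M0 ML] Mv; rewrite -[_ *: _]addr0; exact: ML.
Qed.

Lemma linear_subspace_sum M (s : seq V) (F : V -> V) : linear_subspace M ->
  (forall v, v \in s -> M (F v)) -> M (\sum_(v <- s) F v).
Proof.
move=> /linear_subspaceP[M0 ML] MF; rewrite big_seq.
by apply: big_ind => // u v Mu Mv; rewrite -[u]scale1r; exact: ML.
Qed.

Lemma lin_comb_min B M : linear_subspace M -> B `<=` M -> lin_comb B `<=` M.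
Proof.
move=> Msub BM _ [s [c [sB ->]]]; apply: linear_subspace_sum => // v vs.
by apply: linear_subspaceZ => //; apply: BM; exact: sB.
Qed.

Lemma sub_lin_comb B : B `<=` lin_comb B.
Proof.
move=> v Bv; exists [:: v], (fun=> 1); split; last first.
  by rewrite big_seq1 scale1r.
by move=> u /=; rewrite inE => /eqP ->.
Qed.

(** Linear combinations are indexed by lists that may repeat a vector; this
    brings two of them to a common duplicate-free list, by moving the
    multiplicities into the coefficients. *)
Lemma sum_undup (r s : seq V) (c : V -> R) : {subset r <= s} ->
  \sum_(v <- r) c v *: v = \sum_(v <- undup s) (c v *+ count_mem v r) *: v.
Proof.
move=> rs; rewrite -big_undup_iterop_count.
rewrite [RHS](bigID (fun v => v \in r))/= [X in _ + X]big1 ?addr0; last first.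
  by move=> v /count_memPn ->; rewrite mulr0n scale0r.
rewrite -[RHS]big_filter.
have rsE : perm_eq [seq v <- undup s | v \in r] (undup r).
  apply: uniq_perm; [exact/filter_uniq/undup_uniq|exact: undup_uniq|].
  move=> v; rewrite mem_filter !mem_undup.
  by case vr: (v \in r) => //=; apply: rs.
rewrite (perm_big _ rsE).
by apply: eq_bigr => v _; rewrite -scalerMnl.
Qed.

Lemma lin_comb_uniq B x : lin_comb B x -> exists (s : seq V) (c : V -> R),
  [/\ uniq s, [set` s] `<=` B & x = \sum_(v <- s) c v *: v].
Proof.
move=> [s [c [sB ->]]]; exists (undup s), (fun v => c v *+ count_mem v s).
split; [exact: undup_uniq| |exact: sum_undup].
by move=> v; rewrite /= mem_undup => /sB.
Qed.

Lemma lin_comb_subspace B : linear_subspace (lin_comb B).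
Proof.
apply/linear_subspaceP; split.
  by exists [::], (fun=> 0); rewrite big_nil; split => // v; rewrite /= in_nil.
move=> a _ _ [s [c [sB ->]]] [t [d [tB ->]]].
exists (undup (s ++ t)), (fun v => a * (c v *+ count_mem v s) +
                                    d v *+ count_mem v t).
split=> [v|]; first by rewrite /= mem_undup mem_cat => /orP[/sB|/tB].
rewrite (@sum_undup s (s ++ t)) ?(@sum_undup t (s ++ t)).
- rewrite scaler_sumr -big_split /=.
  by apply: eq_bigr => v _; rewrite scalerDl scalerA.
- by move=> v vt; rewrite mem_cat vt orbT.
- by move=> v vs; rewrite mem_cat vs.
Qed.

(** The abstract form of the theorem. From a subspace [M] with basis [B] that
    meets [Y] only in 0, one builds the tilted basis [T @` B], whose span meets
    [Y] only in 0 but has [g] in its closure. The hypothesis on [N] is the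
    only link between [N] and the linear structure: it provides the scalars
    that make basis vectors small. *)
Lemma not_spaceable_setD X Y (N : V -> \bar R) g (alpha beta : Type) :
  linear_subspace X -> linear_subspace Y -> X g -> Y g -> g != 0 ->
  (forall f, X f -> forall e : R, 0 < e ->
    exists2 a : R, a != 0 & (N (a *: f) < e%:E)%E) ->
  [set: nat] #<= [set: alpha] ->
  ~ spaceable X (norm_open X N) (X `\` Y) alpha beta.
Proof.
move=> Xsub Ysub Xg Yg g0 small alpha_inf.
move=> [[M [Msub MX [B [Bind BM Bal]] MA]] sp].
have M0 : M 0 by case/linear_subspaceP: Msub.
have MYg x : M x -> Y x -> x = 0 by move=> /MA[[]|].
(* [g] lies outside [M], so the [M]-part and the [g]-part of a vector are
   independent. *)
have Mg b x : M x -> M (x + b *: g) -> b = 0.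
  move=> Mx Mxg; apply/eqP/negPn/negP => b0; move: g0; rewrite (MYg g) ?eqxx//.
  have -> : g = b^-1 *: ((x + b *: g) - x).
    by rewrite addrC addKr scalerA mulVf// scale1r.
  by apply: linear_subspaceZ => //; apply: linear_subspaceB.
have XB v : B v -> X v.
  by move=> Bv; apply: MX; rewrite -BM; exact: sub_lin_comb.
have MB v : B v -> M v by move=> Bv; rewrite -BM; exact: sub_lin_comb.
(* As [B] is infinite, it can be labelled by [p] so that every natural number
   occurs; [a v] then makes [v] smaller than the inverse of the successor of its
   label. *)
have /pcard_surjP[p psurj] : [set: nat] #<= B.
  apply: card_le_trans alpha_inf _.
  by have := Bal; rewrite card_eq_le => /andP[].
have /choice[a aP] v : exists a : R, a != 0 /\
    (B v -> (N (a *: v) < ((p v).+1%:R^-1)%:E)%E).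
  have [Bv|nBv] := pselect (B v); last by exists 1; rewrite oner_eq0.
  have [|a a0 Na] := small v (XB _ Bv) (p v).+1%:R^-1.
    by rewrite invr_gt0.
  by exists a.
pose T v := v + (a v)^-1 *: g.
have /choice[S SP] u : exists v, (T @` B) u -> B v /\ T v = u.
  have [[v Bv <-]|nu] := pselect ((T @` B) u); first by exists v.
  by exists 0.
(* [S] undoes [T], so a combination of tilted vectors splits into the same
   combination of the original ones and a multiple of [g]. *)
have sumT (s : seq V) (c : V -> R) : [set` s] `<=` T @` B ->
    \sum_(u <- s) c u *: u =
    \sum_(u <- s) c u *: S u + (\sum_(u <- s) c u / a (S u)) *: g.
  move=> sB; rewrite scaler_suml -big_split/= !big_seq.
  apply: eq_bigr => u us; have [_ Tu] := SP u (sB _ us).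
  by rewrite -[X in _ *: X = _]Tu /T scalerDr scalerA.
have MsumS (s : seq V) (c : V -> R) : [set` s] `<=` T @` B ->
    M (\sum_(u <- s) c u *: S u).
  move=> sB; apply: linear_subspace_sum => // u us.
  by apply: linear_subspaceZ => //; apply: MB; case: (SP u (sB _ us)).
have indS (s : seq V) (c : V -> R) : uniq s -> [set` s] `<=` T @` B ->
    \sum_(u <- s) c u *: S u = 0 -> forall u, u \in s -> c u = 0.
  move=> us sB s0 u uins; have [_ <-] := SP u (sB _ uins).
  apply: (Bind (map S s) (c \o T)).
  - rewrite map_inj_in_uniq// => x y xs ys Sxy.
    have [_ <-] := SP x (sB _ xs); have [_ <-] := SP y (sB _ ys).
    by rewrite Sxy.
  - by move=> _ /= /mapP[v vs ->]; case: (SP v (sB _ vs)).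
  - rewrite big_map -[RHS]s0 !big_seq; apply: eq_bigr => v vs /=.
    by have [_ ->] := SP v (sB _ vs).
  - exact: map_f.
have TX : T @` B `<=` X.
  move=> _ [v Bv <-]; rewrite /T addrC.
  by case/linear_subspaceP: Xsub => _; apply => //; exact: XB.
have wit : lineable_witness X (X `\` Y) alpha (lin_comb (T @` B)).
  split.
  - exact: lin_comb_subspace.
  - exact: lin_comb_min.
  - exists (T @` B); split => //.
      move=> s c us sB; rewrite sumT// => s0; apply: indS => //.
      have b0 : \sum_(u <- s) c u / a (S u) = 0.
        by apply: (Mg _ (\sum_(u <- s) c u *: S u)); [exact: MsumS|rewrite s0].
      by move: s0; rewrite b0 scale0r addr0.
    apply: card_eq_trans Bal; apply: inj_card_eq => u v.
    rewrite !inE => Bu Bv Tuv.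
    have Huv : u + ((a u)^-1 - (a v)^-1) *: g = v.
      by rewrite scalerBl addrA -/(T u) Tuv /T addrK.
    have b0 : (a u)^-1 - (a v)^-1 = 0.
      by apply: (Mg _ u); [exact: MB|rewrite Huv; exact: MB].
    by move: Huv; rewrite b0 scale0r addr0.
  - move=> x lx; have [Yx|nYx] := pselect (Y x); last first.
      by left; split => //; exact: (lin_comb_min Xsub TX).
    right; have [s [c [us sB xE]]] := lin_comb_uniq lx.
    have m0 : \sum_(u <- s) c u *: S u = 0.
      apply: MYg; first exact: MsumS.
      have -> : \sum_(u <- s) c u *: S u =
          x - (\sum_(u <- s) c u / a (S u)) *: g by rewrite xE sumT// addrK.
      by apply: linear_subspaceB => //; apply: linear_subspaceZ.
    rewrite /= xE big_seq big1// => u /(indS _ _ us sB m0) ->.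
    by rewrite scale0r.
have [M' [M'sub M'X [_ M'op] _ [TM' M'A]]] := sp _ wit.
have nM'g : ~ M' g.
  by move=> /M'A[[_]//|/= g00]; move: g0; rewrite g00 eqxx.
have [//|e e0 eP] := M'op g _.
(* The vector [a v *: T v] is [a v *: v + g], and [a v *: v] is small. *)
have [n /= ne] := filter_ex (near_infty_natSinv_lt (PosNum e0)).
have [v Bv pv] : (p @` B) n by apply: psurj.
have [av0 /(_ Bv) Nav] := aP v.
have M'h : M' (a v *: T v).
  apply: linear_subspaceZ => //; apply: TM'; apply: sub_lin_comb.
  by exists v.
have := eP (a v *: T v) (M'X _ M'h) _; case=> //.
rewrite /T scalerDr scalerA mulfV// scale1r addrK (lt_trans Nav)//.
by rewrite lte_fin pv.
Qed.

End linear_algebra.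

(** * Orlicz functions and integrals over the positive half-line *)

Section orlicz_functions.
Context {R : realType}.
Implicit Types (phi psi : R -> R) (x y : \bar R).

Lemma orlicz_ge0 phi u : orlicz_function phi -> 0 <= u -> 0 <= phi u.
Proof.
move=> [_ phi0 _ phi_gt0]; rewrite le_eqVlt => /predU1P[<-|/phi_gt0/ltW//].
by rewrite phi0.
Qed.

(** Convexity between [u] and 0, where [phi] vanishes. *)
Lemma orlicz_scale phi (a u : R) : orlicz_function phi ->
  0 <= a <= 1 -> 0 <= u -> phi (a * u) <= a * phi u.
Proof.
move=> [phi_conv phi0 _ _] /andP[a0 a1] u0.
have h0 (v : R) : 0 <= v -> v \in (half_line : set R).
  by move=> v0; rewrite inE /half_line /= in_itv /= v0.
have := phi_conv (Itv01 a0 a1) u 0 (h0 _ u0) (h0 _ (lexx 0)).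
rewrite [in leRHS]convRE /= phi0 mulr0 addr0; congr (phi _ <= _).
change (a *: (u : R^o) + (1 - a) *: (0 : R^o) = a * u).
by rewrite scaler0 addr0.
Qed.

Lemma orlicz_le phi (u v : R) : orlicz_function phi -> 0 <= u -> u <= v ->
  phi u <= phi v.
Proof.
move=> phiO u0 uv; have v0 := le_trans u0 uv.
have [v0E|v_neq0] := eqVneq v 0.
  by rewrite (@le_anti _ _ u v)// uv v0E u0.
have v_gt0 : 0 < v by rewrite lt_neqAle eq_sym v_neq0.
have uv1 : 0 <= u / v <= 1 by rewrite divr_ge0//= ler_pdivrMr// mul1r.
have := orlicz_scale phiO uv1 v0; rewrite divfK// => /le_trans; apply.
by rewrite ler_piMl ?orlicz_ge0//; case/andP: uv1.
Qed.

Lemma ereal_ext_ge0 phi x : orlicz_function phi -> (0 <= x)%E ->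
  (0 <= ereal_ext phi x)%E.
Proof.
by move=> phiO; case: x => //= r; rewrite !lee_fin; exact: orlicz_ge0.
Qed.

Lemma ereal_ext_le phi x y : orlicz_function phi -> (0 <= x)%E -> (x <= y)%E ->
  (ereal_ext phi x <= ereal_ext phi y)%E.
Proof.
move=> phiO; case: x y => [r||] [s||]//=; rewrite ?leey// !lee_fin.
exact: orlicz_le.
Qed.

Lemma ereal_ext_scale phi (a : R) x : orlicz_function phi ->
  0 < a <= 1 -> (0 <= x)%E ->
  (ereal_ext phi (a%:E * x) <= a%:E * ereal_ext phi x)%E.
Proof.
move=> phiO /andP[a0 a1]; case: x => [r||]//=.
  by rewrite !lee_fin => r0; apply: orlicz_scale => //; rewrite ltW.
by move=> _; rewrite gt0_muley ?lte_fin//= leey.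
Qed.

Lemma ereal_ext_prec phi psi (b : R) x : 0 < b ->
  (forall u, 0 <= u -> phi u <= psi (b * u)) -> (0 <= x)%E ->
  (ereal_ext phi x <= ereal_ext psi (b%:E * x))%E.
Proof.
move=> b0 phipsi; case: x => [r||]//=; first by rewrite !lee_fin => /phipsi.
by move=> _; rewrite gt0_muley ?lte_fin//= leey.
Qed.

End orlicz_functions.

Section positive_half_line.
Context {R : realType}.
Local Open Scope ereal_scope.
Notation mu := (@lebesgue_measure R).
Notation Rpos := (`]0%R, +oo[%classic : set R).
Implicit Types F : R -> \bar R.

Definition decreasing_on_pos F :=
  forall s t : R, (0 < s)%R -> (s <= t)%R -> F t <= F s.

(** The superlevel sets of a monotone function are intervals. *)
Lemma measurable_decreasing_on_pos F : decreasing_on_pos F ->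
  measurable_fun Rpos F.
Proof.
move=> Fd mD.
apply: (measurability _ (ErealGenOInfty.measurableE R)) => //.
move=> _ [_ [x ->] <-]; apply: is_interval_measurable => s t/=.
rewrite !in_itv/= !andbT => -[s0 Fs] [t0 Ft] u /andP[su ut].
have u0 := lt_le_trans s0 su.
split; first by rewrite /= in_itv/= u0.
by rewrite in_itv/= andbT (lt_le_trans Ft)// Fd.
Qed.

(** Lebesgue measure is twice its image under the doubling map, by uniqueness
    on half-open intervals. *)
Lemma integral_pos_double F : measurable_fun Rpos F ->
  (forall t, (0 < t)%R -> 0 <= F t) ->
  \int[mu]_(t in Rpos) F t = 2%:E * \int[mu]_(t in Rpos) F (2 * t)%R.
Proof.
move=> mF F0.
pose d (x : measurableTypeR R) : measurableTypeR R := (2 * x)%R.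
have md : measurable_fun setT d by exact: measurable_funM.
pose pf : {measure set (measurableTypeR R) -> \bar R} :=
  measure_function_pushforward__canonical__measure_function_Measure mu md.
pose nu : {measure set (measurableTypeR R) -> \bar R} :=
  mscale (NngNum (ler0n R 2)) pf.
transitivity (\int[nu]_(t in Rpos) F t).
  apply: eq_measure_integral => A mA _; apply: lebesgue_measure_unique => //.
  move=> _ [[a b] _ <-] /=; rewrite /nu /mscale /= /pushforward.
  have -> : d @^-1` `]a, b] = `](a / 2)%R, (b / 2)%R]%classic.
    apply/seteqP; split=> x /=; rewrite !in_itv/= /d; lra.
  rewrite !lebesgue_measure_itv/= !lte_fin ltr_pM2r ?invr_gt0//.
  case: ifPn => _; last by rewrite mule0.
  by rewrite -!EFinB -EFinM; congr (_%:E); field.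
rewrite ge0_integral_mscale//=; last first.
  by move=> t; rewrite in_itv/= andbT; exact: F0.
rewrite ge0_integral_pushforward//=; last first.
  by move=> t; rewrite inE/= in_itv/= andbT; exact: F0.
rewrite (_ : d @^-1` _ = Rpos)//.
by apply/seteqP; split=> x /=; rewrite !in_itv/= /d; lra.
Qed.

End positive_half_line.

(** * Decreasing rearrangements and the modular *)

Section rearrangement.
Context {R : realType}.
Local Open Scope ereal_scope.
Implicit Types (f g h : L0 R) (lambda t : R).

Lemma measurable_superlevel f lambda :
  measurable ([set t | (lambda < `|f t|)%R] : set lebesgue_line).
Proof.
rewrite -[X in measurable X]setTI.
have -> : [set t | (lambda < `|f t|)%R] =
    (@Num.norm _ R \o f) @^-1` `]lambda, +oo[%classic.
  by apply/seteqP; split=> x /=; rewrite in_itv/= andbT.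
by apply: (measurableT_comp (@normr_measurable R setT)).
Qed.

Lemma ae_le_measure d (T : measurableType d) (mu : {measure set T -> \bar R})
    (A B : set T) : measurable A -> measurable B ->
  (\forall t \ae mu, A t -> B t) -> mu A <= mu B.
Proof.
move=> mA mB [N [mN N0 subN]].
apply: (@le_trans _ _ (mu (B `|` N))).
  apply: le_measure; rewrite ?inE//; first exact: measurableU.
  move=> t At; have [Bt|nBt] := pselect (B t); [by left|right].
  by apply: subN => /= /(_ At).
by apply: (le_trans (measureU2 _ mB mN)); rewrite [X in _ + X]N0 adde0.
Qed.

(** If [h] exceeds [lambda] at a point, so does one of [f] and [g]. *)
Lemma distribution_fun_max f g h lambda :
  (\forall t \ae mI, (`|h t| <= Num.max `|f t| `|g t|)%R) ->
  distribution_fun h lambda <=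
    distribution_fun f lambda + distribution_fun g lambda.
Proof.
move=> hfg; have mf := measurable_superlevel f lambda.
have mg := measurable_superlevel g lambda.
apply: le_trans (measureU2 _ mf mg).
apply: ae_le_measure; [exact: measurable_superlevel|exact: measurableU|].
by apply: filterS hfg => t /= + lh => /(lt_le_trans lh); rewrite lt_max => /orP.
Qed.

Lemma distribution_fun_le f g lambda :
  (\forall t \ae mI, (`|f t| <= `|g t|)%R) ->
  distribution_fun f lambda <= distribution_fun g lambda.
Proof.
move=> fg; apply: ae_le_measure; [exact: measurable_superlevel..|].
by apply: filterS fg => t /= + lf => /(lt_le_trans lf).
Qed.

Lemma distribution_fun_decr f (lambda lambda' : R) : (lambda <= lambda')%R ->
  distribution_fun f lambda' <= distribution_fun f lambda.
Proof.
move=> ll; apply: le_measure; rewrite ?inE; [exact: measurable_superlevel..|].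
by move=> t /=; exact: le_lt_trans.
Qed.

Lemma rearrangement_ge0 f t : 0 <= rearrangement f t.
Proof. by apply: le_ereal_inf_tmp => _ [l [l0 _] <-]; rewrite lee_fin ltW. Qed.

Lemma rearrangement_leP f t lambda : (0 < lambda)%R ->
  distribution_fun f lambda <= t%:E -> rearrangement f t <= lambda%:E.
Proof. by move=> l0 dl; apply: ereal_inf_lbound; exists lambda. Qed.

Lemma rearrangement_ltP f t x : rearrangement f t < x ->
  exists lambda, [/\ (0 < lambda)%R, distribution_fun f lambda <= t%:E &
                     lambda%:E < x].
Proof. by move=> /ereal_inf_lt[_ [l [l0 dl] <-] lx]; exists l. Qed.

Lemma rearrangement_decr f (s t : R) : (s <= t)%R ->
  rearrangement f t <= rearrangement f s.
Proof.
move=> st; apply: le_ereal_inf_tmp => _ [l [l0 dl] <-].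
by apply: rearrangement_leP => //; rewrite (le_trans dl)// lee_fin.
Qed.

Lemma rearrangement_le f g t : (\forall t \ae mI, (`|f t| <= `|g t|)%R) ->
  rearrangement f t <= rearrangement g t.
Proof.
move=> fg; apply: le_ereal_inf_tmp => _ [l [l0 dl] <-].
apply: rearrangement_leP => //; apply: le_trans dl.
exact: distribution_fun_le.
Qed.

Lemma rearrangementZ (a : R) f t : (0 < a)%R ->
  rearrangement (a *: f) t <= a%:E * rearrangement f t.
Proof.
move=> a0; rewrite -lee_pdivrMl//; apply: le_ereal_inf_tmp => _ [l [l0 dl] <-].
rewrite lee_pdivrMl// -EFinM; apply: rearrangement_leP; first exact: mulr_gt0.
apply: le_trans dl; apply: ae_le_measure; [exact: measurable_superlevel..|].
apply: filterS (L0_scaleE a f) => s /= ->.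
by rewrite normrM gtr0_norm// ltr_pM2l.
Qed.

(** If [l] and [m] are levels that [f] and [g] exceed on sets of measure at
    most [t], then [h] exceeds the larger level on a set of measure at most
    [2 * t]. *)
Lemma rearrangement_max f g h t :
  (\forall t \ae mI, (`|h t| <= Num.max `|f t| `|g t|)%R) ->
  rearrangement h (2 * t)%R <= maxe (rearrangement f t) (rearrangement g t).
Proof.
move=> hfg; rewrite leNgt; apply/negP; rewrite gt_max => /andP[].
move=> /rearrangement_ltP[l [l0 dl lh]] /rearrangement_ltP[m [m0 dm mh]].
suff : rearrangement h (2 * t)%R <= (Num.max l m)%:E.
  by rewrite leNgt EFin_max gt_max lh mh.
apply: rearrangement_leP; first by rewrite lt_max l0.
apply: (le_trans (distribution_fun_max _ hfg)).
rewrite mulr_natl mulr2n EFinD leeD//.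
  by apply: le_trans dl; apply: distribution_fun_decr; rewrite le_max lexx.
by apply: le_trans dm; apply: distribution_fun_decr; rewrite le_max lexx orbT.
Qed.

End rearrangement.

Section modular.
Context {R : realType}.
Variables (phi w : R -> R).
Hypotheses (phiO : orlicz_function phi) (wW : weight_function w).
Local Open Scope ereal_scope.
Notation mu := (@lebesgue_measure R).
Notation Rpos := (`]0%R, +oo[%classic : set R).
Implicit Types (f g h : L0 R) (t : R).

Definition modular_integrand f t : \bar R :=
  ereal_ext phi (rearrangement f t) * (w t)%:E.

Lemma Rpos_gt0 t : Rpos t -> (0 < t)%R.
Proof. by rewrite /= in_itv/= andbT. Qed.

Lemma modular_integrand_ge0 f t : (0 < t)%R -> 0 <= modular_integrand f t.
Proof.
case: wW => w0 _ _ _ t0; rewrite mule_ge0//; last by rewrite lee_fin ltW// w0.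
exact/ereal_ext_ge0/rearrangement_ge0.
Qed.

(** Monotonicity is also what makes the integrand measurable. *)
Lemma modular_integrand_decr f : decreasing_on_pos (modular_integrand f).
Proof.
case: wW => w0 wd _ _ s t s0 st; have t0 := lt_le_trans s0 st.
apply: lee_pmul; rewrite ?lee_fin ?wd//; last 2 first.
- exact/ltW/w0.
- apply: ereal_ext_le => //; first exact: rearrangement_ge0.
  exact: rearrangement_decr.
- exact/ereal_ext_ge0/rearrangement_ge0.
Qed.

Lemma measurable_modular_integrand f :
  measurable_fun Rpos (modular_integrand f).
Proof.
by apply: measurable_decreasing_on_pos; exact: modular_integrand_decr.
Qed.

(** The weight is only constrained on positive numbers; the value of the
    integrand at 0, which may even be negative, does not count. *)
Lemma modularE f : modular phi w f = \int[mu]_(t in Rpos) modular_integrand f t.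
Proof.
rewrite /modular /half_line -integral_itv_obnd_cbnd//.
exact: measurable_modular_integrand.
Qed.

Lemma modular_ge0 f : 0 <= modular phi w f.
Proof.
rewrite modularE; apply: integral_ge0 => t /Rpos_gt0.
exact: modular_integrand_ge0.
Qed.

Lemma modular_le f g : (\forall t \ae mI, (`|f t| <= `|g t|)%R) ->
  modular phi w f <= modular phi w g.
Proof.
move=> fg; rewrite !modularE; apply: ge0_le_integral => //.
- by move=> t /Rpos_gt0; exact: modular_integrand_ge0.
- exact: measurable_modular_integrand.
- exact: measurable_modular_integrand.
- move=> t /Rpos_gt0 t0; case: wW => w0 _ _ _.
  apply: lee_wpmul2r; first by rewrite lee_fin ltW// w0.
  apply: ereal_ext_le; [by []|exact: rearrangement_ge0|exact: rearrangement_le].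
Qed.

(** Substitute [2 * t] for [t] in the modular of [h]: by [rearrangement_max]
    the rearrangement becomes at most the larger of those of [f] and [g], and
    the weight does not increase. The factor 2 is the Jacobian. *)
Lemma modular_max f g h :
  (\forall t \ae mI, (`|h t| <= Num.max `|f t| `|g t|)%R) ->
  modular phi w h <= 2%:E * (modular phi w f + modular phi w g).
Proof.
move=> hfg; rewrite !modularE integral_pos_double; last 2 first.
- exact: measurable_modular_integrand.
- by move=> t; exact: modular_integrand_ge0.
have ge0 k t : Rpos t -> 0 <= modular_integrand k t.
  by move=> /Rpos_gt0; exact: modular_integrand_ge0.
rewrite lee_pmul2l ?lte_fin// -ge0_integralD//; first last.
- exact: measurable_modular_integrand.
- by move=> t; exact: ge0.
- exact: measurable_modular_integrand.
- by move=> t; exact: ge0.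
apply: ge0_le_integral => //.
- by move=> t /Rpos_gt0 t0; apply: modular_integrand_ge0; rewrite mulr_gt0.
- apply: measurable_decreasing_on_pos => s t s0 st.
  by apply: modular_integrand_decr; rewrite ?mulr_gt0// ler_pM2l.
- by apply: emeasurable_funD; exact: measurable_modular_integrand.
move=> t /Rpos_gt0 t0; case: wW => w0 wd _ _.
have t2 : (t <= 2 * t)%R by rewrite mulr_natl mulr2n lerDl ltW.
have ext0 k : 0 <= ereal_ext phi (rearrangement k t).
  exact/ereal_ext_ge0/rearrangement_ge0.
rewrite /modular_integrand -ge0_muleDl//.
apply: lee_pmul; rewrite ?lee_fin ?wd//; last 2 first.
- by rewrite ltW// w0// mulr_gt0.
- apply: (@le_trans _ _ (ereal_ext phi
      (maxe (rearrangement f t) (rearrangement g t)))).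
    apply: ereal_ext_le => //; first exact: rearrangement_ge0.
    exact: rearrangement_max.
  have [_|_] := leP (rearrangement f t) (rearrangement g t).
    by rewrite leeDr.
  by rewrite leeDl.
- exact/ereal_ext_ge0/rearrangement_ge0.
Qed.

Lemma modularZ (a : R) f : (0 < a <= 1)%R ->
  modular phi w (a *: f) <= a%:E * modular phi w f.
Proof.
move=> a01; have /andP[a0 _] := a01.
have ge0 k t : Rpos t -> 0 <= modular_integrand k t.
  by move=> /Rpos_gt0; exact: modular_integrand_ge0.
rewrite !modularE -ge0_integralZl//; last 3 first.
- exact: measurable_modular_integrand.
- by move=> t; exact: ge0.
- by rewrite lee_fin ltW.
apply: ge0_le_integral => //.
- by move=> t; exact: ge0.
- exact: measurable_modular_integrand.
- by apply: measurable_funeM; exact: measurable_modular_integrand.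
move=> t /Rpos_gt0 t0; case: wW => w0 wd _ _.
rewrite /modular_integrand muleA.
apply: lee_wpmul2r; first by rewrite lee_fin ltW// w0.
apply: le_trans (ereal_ext_scale phiO a01 (rearrangement_ge0 f t)).
by apply: ereal_ext_le; [by []|exact: rearrangement_ge0|exact: rearrangementZ].
Qed.

End modular.

(** Applied to [f] in place of [b^-1 *: f], the domination of [phi] by [psi]
    would need the rearrangement of [b *: f] from below; scaling by [b^-1]
    makes the upper bound of [rearrangementZ] sufficient. *)
Lemma modular_prec (R : realType) (phi psi w : R -> R) (b : R) (f : L0 R) :
  orlicz_function phi -> orlicz_function psi -> weight_function w -> 0 < b ->
  (forall u, 0 <= u -> phi u <= psi (b * u)) ->
  (modular phi w (b^-1 *: f) <= modular psi w f)%E.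
Proof.
move=> phiO psiO wW b0 phipsi; rewrite !modularE//.
apply: ge0_le_integral => //.
- by move=> t /Rpos_gt0; exact: modular_integrand_ge0.
- exact: measurable_modular_integrand.
- exact: measurable_modular_integrand.
move=> t /Rpos_gt0 t0; case: (wW) => w0 wd _ _.
apply: lee_wpmul2r; first by rewrite lee_fin ltW// w0.
apply: (le_trans (ereal_ext_prec b0 phipsi (rearrangement_ge0 _ t))).
apply: ereal_ext_le => //.
  by rewrite mule_ge0 ?rearrangement_ge0// lee_fin ltW.
by rewrite -lee_pdivlMl// rearrangementZ// invr_gt0.
Qed.

(** * Order ideals and the Luxemburg norm *)

Section order_ideal.
Context {R : realType}.
Implicit Types (X : set (L0 R)) (f g h : L0 R).

(** Equivalently, a nonempty solid vector subspace of the Riesz space [L0]. The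
    condition is stated with a maximum instead of a sum because distribution
    functions handle the maximum without loss. *)
Definition order_ideal X : Prop := X !=set0 /\
  forall (C : R) f g h, 0 < C -> X f -> X g ->
    (\forall t \ae mI, `|h t| <= C * Num.max `|f t| `|g t|) -> X h.

Lemma order_ideal_subspace X : order_ideal X -> linear_subspace X.
Proof.
move=> [[f Xf] Xmax]; apply/linear_subspaceP; split.
  apply: (Xmax 1 f f) => //; apply: filterS L0_zeroE => t ->.
  by rewrite normr0 mul1r le_max normr_ge0.
move=> a u v Xu Xv; apply: (Xmax (`|a| + 1) u v) => //.
apply: filterS2 (L0_addE (a *: u) v) (L0_scaleE a u) => t -> ->.
rewrite (le_trans (ler_normD _ _))// mulrDl mul1r normrM lerD//.
  by rewrite ler_wpM2l// le_max lexx.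
by rewrite le_max lexx orbT.
Qed.

End order_ideal.

Section luxemburg.
Context {R : realType}.
Variables (phi w : R -> R).
Hypotheses (phiO : orlicz_function phi) (wW : weight_function w).
Local Open Scope ereal_scope.
Implicit Types (f g h : L0 R) (t : R).
Local Notation norm := (luxemburg_norm phi w).
Local Notation Lambda := (orlicz_lorentz phi w).

Lemma scale_max_le (C k1 k2 : R) f g h :
  (0 < C)%R -> (0 < k1)%R -> (0 < k2)%R ->
  (\forall t \ae mI, (`|h t| <= C * Num.max `|f t| `|g t|)%R) ->
  \forall t \ae mI, (`|(Num.min k1 k2 / C *: h : L0 R) t| <=
     Num.max `|(k1 *: f : L0 R) t| `|(k2 *: g : L0 R) t|)%R.
Proof.
move=> C0 k10 k20 hfg.
have hE := L0_scaleE (Num.min k1 k2 / C)%R h.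
have fE := L0_scaleE k1 f; have gE := L0_scaleE k2 g.
apply: filterS2 (filterI hE hfg) (filterI fE gE) => t [-> hC] [-> ->].
have k0 : (0 < Num.min k1 k2)%R by rewrite lt_min k10.
rewrite normrM (gtr0_norm (divr_gt0 k0 C0)) !normrM.
rewrite (gtr0_norm k10) (gtr0_norm k20).
have : (Num.min k1 k2 / C * `|h t| <= Num.min k1 k2 * Num.max `|f t| `|g t|)%R.
  by rewrite -mulrA ler_pM2l// ler_pdivrMl.
move=> /le_trans; apply; rewrite (maxr_pMr _ _ (ltW k0)) ge_max !le_max.
by apply/andP; split; apply/orP; [left|right];
  rewrite ler_wpM2r// ge_min lexx ?orbT.
Qed.

Lemma orlicz_lorentz_max (C : R) f g h : (0 < C)%R -> Lambda f -> Lambda g ->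
  (\forall t \ae mI, (`|h t| <= C * Num.max `|f t| `|g t|)%R) -> Lambda h.
Proof.
move=> C0 [k1 k10 k1f] [k2 k20 k2g] hfg.
exists (Num.min k1 k2 / C)%R; first by rewrite divr_gt0// lt_min k10.
apply: (le_lt_trans (modular_max phiO wW (scale_max_le C0 k10 k20 hfg))).
apply: lte_mul_pinfty; [by rewrite lee_fin|by []|].
exact: lte_add_pinfty k1f k2g.
Qed.

Lemma luxemburg_norm_ge0 f : 0 <= norm f.
Proof. by apply: le_ereal_inf_tmp => _ [e [e0 _] <-]; rewrite lee_fin ltW. Qed.

Lemma luxemburg_norm_le_fin f (e : R) : (0 < e)%R ->
  modular phi w (e^-1 *: f) <= 1 -> norm f <= e%:E.
Proof. by move=> e0 fe; apply: ereal_inf_lbound; exists e. Qed.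

Lemma luxemburg_norm_lt f (e : R) : norm f < e%:E ->
  modular phi w (e^-1 *: f) <= 1.
Proof.
move=> /ereal_inf_lt[_ [d [d0 fd] <-]]; rewrite lte_fin => de.
apply: le_trans fd; apply: modular_le => //.
apply: filterS2 (L0_scaleE e^-1 f) (L0_scaleE d^-1 f) => t -> ->.
have e0 := lt_trans d0 de.
rewrite !normrM ler_wpM2r// !gtr0_norm ?invr_gt0// lef_pV2//.
exact: ltW.
Qed.

Lemma luxemburg_norm_le f g : (\forall t \ae mI, (`|f t| <= `|g t|)%R) ->
  norm f <= norm g.
Proof.
move=> fg; apply: le_ereal_inf_tmp => _ [e [e0 ge] <-].
apply: luxemburg_norm_le_fin e0 _; apply: le_trans ge; apply: modular_le => //.
move: fg (L0_scaleE e^-1 f) (L0_scaleE e^-1 g).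
apply: filterS3 => t fgt -> ->.
by rewrite !normrM ler_wpM2l.
Qed.

(** The factor 1/4 compensates the two summands and the factor 2 of
    [modular_max]. *)
Lemma modular_quarter f (e : R) : modular phi w (e^-1 *: f) <= 1 ->
  modular phi w ((4 * e)^-1 *: f) <= (4^-1)%:E.
Proof.
have q01 : (0 < (4^-1 : R) <= 1)%R by lra.
rewrite invfM -scalerA => fe1.
apply: (le_trans (modularZ phiO wW _ q01)).
rewrite -[leRHS]mule1; apply: lee_wpmul2l fe1; rewrite lee_fin.
by case/andP: q01 => /ltW.
Qed.

(** A quasi-triangle inequality, compatible with the order. *)
Lemma luxemburg_norm_max (C e : R) f g h : (0 < C)%R -> (0 < e)%R ->
  (\forall t \ae mI, (`|h t| <= C * Num.max `|f t| `|g t|)%R) ->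
  norm f < e%:E -> norm g < e%:E -> norm h <= (4 * C * e)%:E.
Proof.
move=> C0 e0 hfg /luxemburg_norm_lt fe /luxemburg_norm_lt ge.
apply: luxemburg_norm_le_fin; first by rewrite !mulr_gt0.
have k0 : (0 < (4 * e)^-1)%R by rewrite invr_gt0 mulr_gt0.
have := modular_max phiO wW (scale_max_le C0 k0 k0 hfg).
have -> : (Num.min (4 * e)^-1 (4 * e)^-1 / C = (4 * C * e)^-1)%R.
  by rewrite minxx -invfM mulrAC.
move=> /le_trans; apply.
apply: (@le_trans _ _ (2%:E * ((4^-1)%:E + (4^-1)%:E))).
  apply: lee_wpmul2l; first by rewrite lee_fin.
  exact: (leeD (modular_quarter fe) (modular_quarter ge)).
by rewrite -EFinD -EFinM (_ : 2 * (4^-1 + 4^-1) = 1 :> R)%R //; field.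
Qed.

(** By convexity a finite modular is brought below 1 by scaling. *)
Lemma luxemburg_norm_small f (e : R) : Lambda f -> (0 < e)%R ->
  exists2 a : R, (0 < a)%R & norm (a *: f) < e%:E.
Proof.
move=> [k k0 fk] e0.
have [M M0 fM] : exists2 M : R, (0 <= M)%R & modular phi w (k *: f) = M%:E.
  have fin : modular phi w (k *: f) \is a fin_num.
    by rewrite ge0_fin_numE// modular_ge0.
  exists (fine (modular phi w (k *: f))); last by rewrite fineK.
  by rewrite fine_ge0// modular_ge0.
clear fk; have M1 : (0 < 1 + M)%R by rewrite ltr_pwDl.
pose d := ((1 + M)^-1)%R.
have d0 : (0 < d)%R by rewrite invr_gt0.
have d1 : (d <= 1)%R by rewrite invf_le1// lerDl.
have e20 : (0 < e / 2)%R by rewrite divr_gt0.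
exists (d * k * (e / 2))%R; first by rewrite !mulr_gt0.
apply: (@le_lt_trans _ _ (e / 2)%:E).
  apply: (luxemburg_norm_le_fin e20).
  rewrite scalerA mulrC mulfK ?gt_eqF// -scalerA.
  have d01 : (0 < d <= 1)%R by rewrite d0.
  apply: (le_trans (modularZ phiO wW _ d01)).
  by rewrite fM -EFinM lee_fin /d ler_pdivrMl// mulr1 lerDr.
by rewrite lte_fin ltr_pdivrMr// ltr_pMr// ltr1n.
Qed.

End luxemburg.

(** * The order-continuous part *)

Section order_continuous.
Context {R : realType}.
Variables (phi w : R -> R).
Hypotheses (phiO : orlicz_function phi) (wW : weight_function w).
Implicit Types (f g h : L0 R) (t : R).
Local Notation norm := (luxemburg_norm phi w).
Local Notation Lambda := (orlicz_lorentz phi w).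
Local Notation La := (order_continuous_part phi w).

Lemma cvge0P (x : nat -> \bar R) : (forall n, 0 <= x n)%E ->
  x n @[n --> \oo] --> 0%E <->
  forall e : R, 0 < e -> \forall n \near \oo, (x n < e%:E)%E.
Proof.
move=> x0; split=> [x_0 e e0|xe].
  have e0' : (0%:E < e%:E)%E by rewrite lte_fin.
  exact: (x_0 [set y | (y < e%:E)%E] (open_ereal_lt' e0')).
apply/fine_cvgP; split.
  apply: filterS (xe 1 ltr01) => n xn.
  by rewrite ge0_fin_numE// (lt_trans xn)// ltry.
apply/cvgrPdist_lt => e e0; apply: filterS (xe _ e0) => n xn.
have xfin : x n \is a fin_num by rewrite ge0_fin_numE// (lt_trans xn)// ltry.
rewrite sub0r normrN /= ger0_norm; last exact: fine_ge0.
by rewrite -lte_fin fineK.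
Qed.

Lemma L0_class (F : R -> R) :
  measurable_fun setT (F : lebesgue_line -> R) ->
  exists f : L0 R, \forall t \ae mI, f t = F t.
Proof.
move=> mF.
pose Fmix := isMeasurableFun.Build _ _ _ _ (F : lebesgue_line -> R) mF.
pose Ffun : {mfun lebesgue_line >-> R} := HB.pack (F : lebesgue_line -> R) Fmix.
by exists (\pi_(L0 R) Ffun)%qT; exact: (L0_reprP Ffun).
Qed.

(** A sequence [u] dominated by [C * max(|f|, |g|)] is truncated at [|f|] and at
    [|g|]: the truncations of [|u| / C] are dominated by [f] and by [g], they
    decrease to 0 with [u], and the larger of the two is [|u| / C]. So
    [luxemburg_norm_max] carries the convergence over to [u]. *)
Lemma order_continuous_part_max (C : R) f g h : 0 < C -> La f -> La g ->
  (\forall t \ae mI, `|h t| <= C * Num.max `|f t| `|g t|) -> La h.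
Proof.
move=> C0 [Lf fcont] [Lg gcont] hfg; split.
  exact: (orlicz_lorentz_max phiO wW C0 Lf Lg hfg).
move=> u u_le u_decr u_0; split.
  by move=> n; apply: luxemburg_norm_le.
have /choice[cut cutP] (kn : L0 R * nat) : exists v : L0 R,
    \forall t \ae mI, v t = Num.min (C^-1 * `|u kn.2 t|) `|kn.1 t|.
  apply: (@L0_class (fun t => Num.min (C^-1 * `|u kn.2 t|) `|kn.1 t|)).
  have mabs (k : L0 R) : measurable_fun setT (fun t : lebesgue_line => `|k t|).
    apply: (measurableT_comp (@normr_measurable R setT)).
    exact: measurable_funPT.
  by apply: measurable_minr; [apply: measurable_funM|exact: mabs].
have cut_cont (k : L0 R) : La k -> norm (cut (k, n)) @[n --> \oo] --> 0%E.
  move=> [_ kcont].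
  have cut_all : \forall t \ae mI, forall n,
      cut (k, n) t = Num.min (C^-1 * `|u n t|) `|k t|.
    by apply: ae_foralln => n; exact: (cutP (k, n)).
  have min_ge0 n t : 0 <= Num.min (C^-1 * `|u n t|) `|k t|.
    by rewrite le_min normr_ge0 andbT mulr_ge0// invr_ge0 ltW.
  apply: (kcont (fun n => cut (k, n)) _ _ _).2.
  - move=> n; apply: filterS cut_all => t ->.
    by rewrite (ger0_norm (min_ge0 _ _)) ge_min lexx orbT.
  - move=> n; apply: filterS2 cut_all (u_decr n) => t cutE un.
    rewrite !cutE !(ger0_norm (min_ge0 _ _)) le_min !ge_min lexx orbT andbT.
    by rewrite ler_wpM2l// invr_ge0 ltW.
  - apply: filterS2 cut_all u_0 => t cutE ut0.
    have : C^-1 * `|u n t| @[n --> \oo] --> (0 : R).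
      by rewrite -[X in _ --> X](mulr0 C^-1); apply: cvgMr.
    apply: squeeze_cvgr; last exact: cvg_cst.
    apply: nearW => n.
    by rewrite normr_ge0 cutE (ger0_norm (min_ge0 _ _)) ge_min lexx.
have x0 := fun n => luxemburg_norm_ge0 phi w (u n).
apply/(cvge0P x0) => e e0.
pose d := e / (8 * C).
have d0 : 0 < d by rewrite divr_gt0// mulr_gt0.
have small k : La k -> \forall n \near \oo, (norm (cut (k, n)) < d%:E)%E.
  move=> Lk; have := cut_cont k Lk.
  by move/cvge0P => /(_ (fun n => luxemburg_norm_ge0 phi w _) d d0).
have fS := small f (conj Lf fcont); have gS := small g (conj Lg gcont).
apply: filterS2 fS gS => n fn gn.
apply: (@le_lt_trans _ _ (4 * C * d)%:E); last first.
  have -> : 4 * C * d = e / 2 by rewrite /d; field; rewrite gt_eqF.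
  by rewrite lte_fin; lra.
apply: (luxemburg_norm_max phiO wW C0 d0 _ fn gn).
apply: filterS2 (filterI (cutP (f, n)) (cutP (g, n))) (filterI (u_le n) hfg).
move=> t /= [-> ->] [un hC].
have := le_trans un hC; rewrite -ler_pdivrMl// => uC.
have min_ge0 (k : L0 R) : 0 <= Num.min (C^-1 * `|u n t|) `|k t|.
  by rewrite le_min normr_ge0 andbT mulr_ge0// invr_ge0 ltW.
rewrite !(ger0_norm (min_ge0 _)) -ler_pdivrMl// le_max !le_min lexx/=.
by move: uC; rewrite le_max.
Qed.

End order_continuous.

(** * The indicator function of the unit interval *)

(** Continuity from above, after removal of the null set where the sequence of
    sets misbehaves. *)
Lemma ae_decr_cvg_measure0 d (T : measurableType d) (R : realType)
    (mu : {measure set T -> \bar R}) (A : nat -> set T) :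
  (forall n, measurable (A n)) -> (mu (A 0%N) < +oo)%E ->
  (\forall t \ae mu, (forall n, A n.+1 t -> A n t) /\ exists n, ~ A n t) ->
  mu (A n) @[n --> \oo] --> 0%E.
Proof.
move=> mA A0fin [N [mN N0 subN]].
have muE n : mu (A n) = mu (A n `\` N).
  apply/eqP; rewrite eq_le; apply/andP; split; last first.
    apply: le_measure; rewrite ?inE; [exact: measurableD|exact: mA|].
    exact: subDsetl.
  apply: ae_le_measure => //; first exact: measurableD.
  by exists N; split => // t /= nt; apply: contrapT => nNt; apply: nt.
rewrite (_ : (fun n => mu (A n)) = mu \o (fun n => A n `\` N)); last first.
  by apply/funext.
rewrite -(@measure0 _ _ _ mu).
have capE : \bigcap_n (A n `\` N) = set0.
  apply/seteqP; split => // t At.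
  have nNt : ~ N t by case: (At 0%N I).
  have [_ [n nAt]] : (forall n, A n.+1 t -> A n t) /\ exists n, ~ A n t.
    by apply: contrapT => nt; apply: nNt; apply: subN.
  by apply: nAt; case: (At n I).
rewrite -capE; apply: nonincreasing_cvg_mu.
- by rewrite -muE.
- by move=> n; exact: measurableD.
- by rewrite capE.
- apply/nonincreasing_seqP => n; apply/subsetPset => t [At nNt]; split => //.
  have [+ _] : (forall n, A n.+1 t -> A n t) /\ exists n, ~ A n t.
    by apply: contrapT => nt; apply: nNt; apply: subN.
  exact.
Qed.

Section unit_indicator.
Context {R : realType}.
Implicit Types (phi w : R -> R) (g u : L0 R).
Local Notation mu := (@lebesgue_measure R).
Local Notation Rpos := (`]0%R, +oo[%classic : set R).
Local Notation Runit := (`[0%R, 1%R]%classic : set R).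

Lemma measurable_Runit : measurable (Runit : set lebesgue_line).
Proof.
apply: sub_caratheodory.
exact: (measurable_itv `[0%R, 1%R] : @measurable _ (measurableTypeR R) _).
Qed.

Lemma mI_Runit : mI (Runit : set lebesgue_line) = 1%:E.
Proof.
rewrite /mI /= /mrestr setIidl; last first.
  by move=> t; rewrite /half_line /= !in_itv/= => /andP[->].
apply: (etrans (lebesgue_measure_itv `[0%R, 1%R] : mu Runit = _)).
by rewrite /= lte_fin ltr01 oppr0 adde0.
Qed.

Definition is_unit_indicator g := \forall t \ae mI, g t = \1_Runit t.

Lemma unit_indicator_exists : exists g, is_unit_indicator g.
Proof.
apply: L0_class; apply: measurable_indic; exact: measurable_Runit.
Qed.

Lemma unit_indicator_neq0 g : is_unit_indicator g -> g != 0.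
Proof.
move=> gE; apply/negP => /eqP g0.
have : (mI (Runit : set lebesgue_line) <= mI (set0 : set lebesgue_line))%E.
  apply: ae_le_measure => //; first exact: measurable_Runit.
  apply: filterS2 gE L0_zeroE => t; rewrite g0 => -> + Rt.
  by rewrite indicE mem_set//= => /eqP; rewrite oner_eq0.
by rewrite mI_Runit measure0 lee_fin ler10.
Qed.

Section below_indicator.
Variables (phi w : R -> R).
Hypotheses (phiO : orlicz_function phi) (wW : weight_function w).
Variables (g u : L0 R).
Hypotheses (gE : is_unit_indicator g)
  (ug : \forall t \ae mI, `|u t| <= `|g t|).

Lemma below_indicator_distribution lambda : 0 <= lambda ->
  (distribution_fun u lambda <= 1%:E)%E.
Proof.
move=> l0; rewrite -mI_Runit; apply: ae_le_measure.
- exact: measurable_superlevel.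
- exact: measurable_Runit.
apply: filterS2 gE ug => t -> + lu; rewrite indicE.
have [/set_mem//|_] := boolP (t \in Runit).
by rewrite normr0 leNgt (le_lt_trans l0 lu).
Qed.

Lemma below_indicator_distribution1 : distribution_fun u 1 = 0%E.
Proof.
apply/eqP; rewrite -measure_le0 -(@measure0 _ _ _ mI).
apply: ae_le_measure => //; first exact: measurable_superlevel.
apply: filterS2 gE ug => t -> + lu; rewrite indicE leNgt.
by case: (t \in Runit); rewrite ?normr0 ?normr1 ?lu// (lt_trans _ lu).
Qed.

(** A majorant of the integrand of the modular of [k *: u], for every [u] below
    the indicator: such a rearrangement is at most [k], and vanishes
    from 1 on. *)
Definition indicator_majorant (k : R) : R -> \bar R :=
  (fun t => (phi k)%:E * (w t)%:E)%E \_ `]0%R, 1%R[.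

Lemma below_indicator_integrand (k t : R) : 0 < k -> 0 < t ->
  (modular_integrand phi w (k *: u) t <= indicator_majorant k t)%E.
Proof.
move=> k0 t0; case: (wW) => w0 _ _ _.
have kuE := rearrangementZ u t k0.
rewrite /indicator_majorant patchE.
case: ifPn => [_|].
  apply: lee_wpmul2r; first by rewrite lee_fin ltW// w0.
  rewrite -[(phi k)%:E]/(ereal_ext phi k%:E); apply: ereal_ext_le => //.
    exact: rearrangement_ge0.
  apply: (le_trans kuE); rewrite -[leRHS]mule1; apply: lee_wpmul2l.
    by rewrite lee_fin ltW.
  apply: rearrangement_leP => //.
  by rewrite below_indicator_distribution1 lee_fin ltW.
rewrite notin_setE/= in_itv/= t0/= => /negP; rewrite -leNgt => t1.
have u0 : rearrangement u t = 0%E.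
  apply/eqP; rewrite eq_le rearrangement_ge0 andbT.
  apply/lee_addgt0Pr => e e0; rewrite add0e; apply: rearrangement_leP => //.
  by apply: (le_trans (below_indicator_distribution (ltW e0))); rewrite lee_fin.
have ku0 : rearrangement (k *: u) t = 0%E.
  apply/eqP; rewrite eq_le rearrangement_ge0 andbT.
  by apply: (le_trans kuE); rewrite u0 mule0.
rewrite /modular_integrand ku0 /=; case: phiO => _ -> _ _.
by rewrite mul0e.
Qed.

Lemma integrable_indicator_majorant (k : R) : 0 < k ->
  mu.-integrable Rpos (indicator_majorant k).
Proof.
move=> k0; case: (wW) => w0 wd wint _; have pk0 := orlicz_ge0 phiO (ltW k0).
have sub01 : (`]0%R, 1%R[ : set R) `<=` Rpos.
  by move=> t /=; rewrite !in_itv/= => /andP[->].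
have mw : measurable_fun Rpos (fun t => (w t)%:E).
  apply: measurable_decreasing_on_pos => s t s0 st.
  by rewrite lee_fin wd.
have mM : measurable_fun Rpos (indicator_majorant k).
  apply/measurable_restrict => //.
  apply: measurable_funeM; apply: measurable_funS mw => //.
apply/integrableP; split => //.
rewrite (@eq_integral _ _ _ mu Rpos (indicator_majorant k)); last first.
  move=> t; rewrite inE => /Rpos_gt0 t0; rewrite gee0_abs//.
  rewrite /indicator_majorant patchE; case: ifP => // _.
  by rewrite mule_ge0// lee_fin// ltW// w0.
rewrite /indicator_majorant -integral_mkcondr setIidr//.
rewrite ge0_integralZl//.
- by apply: lte_mul_pinfty; [rewrite lee_fin|by []|exact: wint].
- exact: measurable_funS mw.
- by move=> t; rewrite /= in_itv/= => /andP[t0 _]; rewrite lee_fin ltW// w0.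
Qed.

Lemma below_indicator_lorentz : orlicz_lorentz phi w u.
Proof.
exists 1 => //; rewrite modularE//.
have /integrableP[mM] := integrable_indicator_majorant ltr01.
apply: le_lt_trans; apply: ge0_le_integral => //.
- by move=> t /Rpos_gt0; exact: modular_integrand_ge0.
- exact: measurable_modular_integrand.
- exact: measurableT_comp.
move=> t /Rpos_gt0 t0.
apply: le_trans (lee_abs _); exact: below_indicator_integrand.
Qed.

End below_indicator.

End unit_indicator.

Section indicator_order_continuous.
Context {R : realType}.
Variables (phi w : R -> R).
Hypotheses (phiO : orlicz_function phi) (wW : weight_function w).
Local Notation mu := (@lebesgue_measure R).
Local Notation Rpos := (`]0%R, +oo[%classic : set R).

Lemma orlicz_cvg0 (t e : R) : 0 < t -> 0 < e ->
  exists2 d : R, 0 < d & forall x : \bar R, (0 <= x)%E -> (x <= d%:E)%E ->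
    (ereal_ext phi x * (w t)%:E < e%:E)%E.
Proof.
move=> t0 e0; case: (phiO) => _ _ phi_0 _; case: (wW) => w0 _ _ _.
have wt0 := w0 _ t0; have ew0 : 0 < e / w t by rewrite divr_gt0.
have small : \forall d \near 0^'+, `|phi d| < e / w t.
  by move/cvgr0Pnorm_lt : phi_0; exact.
have [d [d0 dsmall]] := filter_ex (filterI (nbhs_right_gt 0) small).
exists d => // x x0 xd; apply: (@le_lt_trans _ _ (phi d * w t)%:E).
  rewrite EFinM; apply: lee_wpmul2r; first by rewrite lee_fin ltW.
  by rewrite -[(phi d)%:E]/(ereal_ext phi d%:E); exact: ereal_ext_le.
by rewrite lte_fin -ltr_pdivlMr// (le_lt_trans (ler_norm _)).
Qed.

(** Functions below the indicator that decrease to 0 have distribution functions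
    that tend to 0, because the unit interval has finite measure. Hence their
    rearrangements tend to 0 pointwise, and so do their modulars, at every
    scale, by dominated convergence. *)
Lemma unit_indicator_order_continuous (g : L0 R) : is_unit_indicator g ->
  order_continuous_part phi w g.
Proof.
move=> gE; split.
  apply: (below_indicator_lorentz phiO wW gE).
  by apply: nearW => t; exact: lexx.
move=> u u_le u_decr u_0; split; first by move=> n; exact: luxemburg_norm_le.
apply/cvge0P; first by move=> n; exact: luxemburg_norm_ge0.
move=> e e0.
(* A modular at most 1 at the scale [k] bounds the norm by [e / 2]. *)
pose k := (e / 2)^-1; have k0 : 0 < k by rewrite invr_gt0 divr_gt0.
have dist0 lambda : 0 < lambda ->
    distribution_fun (u n) lambda @[n --> \oo] --> 0%E.
  move=> l0; apply: ae_decr_cvg_measure0.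
  - by move=> n; exact: measurable_superlevel.
  - apply: (le_lt_trans (below_indicator_distribution gE (u_le 0%N) (ltW l0))).
    exact: ltry.
  have udecr : \forall t \ae mI, forall n, `|u n.+1 t| <= `|u n t|.
    exact: ae_foralln.
  apply: filterS2 udecr u_0 => t ut ut0; split=> [n|].
    by move=> /= /lt_le_trans; apply.
  move/cvgr0Pnorm_lt : ut0 => /(_ _ l0)/filter_ex[n] /=.
  by rewrite normr_id => un; exists n; apply/negP; rewrite -leNgt ltW.
have mod0 : modular phi w (k *: u n) @[n --> \oo] --> 0%E.
  have -> : (fun n => modular phi w (k *: u n)) =
      (fun n => \int[mu]_(t in Rpos) modular_integrand phi w (k *: u n) t)%E.
    by apply/funext => n; rewrite modularE.
  have [] := @dominated_convergence _ _ R mu Rpos _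
    (fun n => modular_integrand phi w (k *: u n)) (cst 0%E)
    (indicator_majorant phi w k).
  - by [].
  - by move=> n; exact: measurable_modular_integrand.
  - exact: measurable_cst.
  - apply: aeW => t /Rpos_gt0 t0; apply/cvge0P.
      by move=> n; exact: modular_integrand_ge0.
    move=> d d0; have [c c0 cP] := orlicz_cvg0 t0 d0.
    have ck0 : 0 < c / k by rewrite divr_gt0.
    have := (cvge0P _).1 (dist0 _ ck0) t t0.
    move=> /(_ (fun n => measure_ge0 _ _)); apply: filterS => n dn.
    apply: cP; first exact: rearrangement_ge0.
    apply: (le_trans (rearrangementZ _ _ k0)).
    rewrite -lee_pdivlMl// -EFinM mulrC.
    by apply: rearrangement_leP => //; exact: ltW.
  - exact: integrable_indicator_majorant.
  - apply: aeW => t n /Rpos_gt0 t0; rewrite gee0_abs ?modular_integrand_ge0//.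
    exact: (below_indicator_integrand phiO wW gE (u_le n)).
  by move=> _ _; rewrite integral0.
have := (cvge0P (fun n => modular_ge0 phiO wW _)).1 mod0 1 ltr01.
apply: filterS => n un; apply: (@le_lt_trans _ _ (e / 2)%:E); last first.
  by rewrite lte_fin ltr_pdivrMr// ltr_pMr// ltr1n.
by apply: luxemburg_norm_le_fin; [rewrite divr_gt0|exact: ltW].
Qed.

End indicator_order_continuous.

(** * The spaces as order ideals, and the conclusion *)

Section spaceability.
Context {R : realType}.

Lemma orlicz_lorentz_ideal (phi w : R -> R) : orlicz_function phi ->
  weight_function w -> order_ideal (orlicz_lorentz phi w).
Proof.
move=> phiO wW; split; last by move=> C f g h; exact: orlicz_lorentz_max.
have [g gE] := unit_indicator_exists (R := R).
by exists g; case: (unit_indicator_order_continuous phiO wW gE).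
Qed.

Lemma order_continuous_part_ideal (phi w : R -> R) : orlicz_function phi ->
  weight_function w -> order_ideal (order_continuous_part phi w).
Proof.
move=> phiO wW; split; last by move=> C f g h; exact: order_continuous_part_max.
have [g gE] := unit_indicator_exists (R := R).
by exists g; exact: unit_indicator_order_continuous.
Qed.

Lemma orlicz_lorentz_prec (phi psi w : R -> R) :
  orlicz_function phi -> orlicz_function psi -> weight_function w ->
  orlicz_prec phi psi -> orlicz_lorentz psi w `<=` orlicz_lorentz phi w.
Proof.
move=> phiO psiO wW [b b0 phipsi] f [k k0 fk]; exists (b^-1 * k).
  by rewrite mulr_gt0// invr_gt0.
rewrite -scalerA; apply: le_lt_trans fk.
exact: modular_prec phiO psiO wW b0 phipsi.
Qed.

(** Two members of an increasing union lie in a common term. *)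
Lemma bigcup_order_ideal (X : nat -> set (L0 R)) :
  (forall n, (1 <= n)%N -> order_ideal (X n)) ->
  (forall n, (1 <= n)%N -> X n `<=` X n.+1) ->
  order_ideal (\bigcup_(n in [set n | (1 <= n)%N]) X n).
Proof.
move=> Xideal Xincr.
have Xle m n : (1 <= m)%N -> (m <= n)%N -> X m `<=` X n.
  move=> m1; elim: n => [|n IH] mn; first by case: m m1 mn.
  move: mn; rewrite leq_eqVlt => /predU1P[->//|]; rewrite ltnS => mn f Xf.
  by apply: Xincr; [exact: leq_trans mn|exact: IH].
split; first by have [[f Xf] _] := Xideal 1%N isT; exists f, 1%N.
move=> C f g h C0 [m m1 Xf] [n n1 Xg] hfg; exists (maxn m n).
  by rewrite /= leq_max m1.
have mn1 : (1 <= maxn m n)%N by rewrite leq_max m1.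
apply: (Xideal _ mn1).2 C0 _ _ hfg.
- exact: Xle (leq_maxl _ _) _ Xf.
- exact: Xle (leq_maxr _ _) _ Xg.
Qed.

Lemma not_spaceable_order_ideal (X Y : set (L0 R)) (phi w : R -> R)
    (g : L0 R) (alpha beta : Type) :
  orlicz_function phi -> weight_function w ->
  order_ideal X -> order_ideal Y -> X `<=` orlicz_lorentz phi w ->
  X g -> Y g -> g != 0 -> [set: nat] #<= [set: alpha] ->
  ~ spaceable X (norm_open X (luxemburg_norm phi w)) (X `\` Y) alpha beta.
Proof.
move=> phiO wW Xi Yi XL Xg Yg g0; apply: not_spaceable_setD Xg Yg g0 _.
- exact: order_ideal_subspace.
- exact: order_ideal_subspace.
move=> f /XL Lf e e0; have [a a0 ae] := luxemburg_norm_small phiO wW Lf e0.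
by exists a => //; rewrite gt_eqF.
Qed.

End spaceability.

Theorem corollary4p5 (R : realType) (alpha : Type) (w phi : R -> R)
  (phi_ : nat -> R -> R)
  (alpha_inf : [set: nat] #<= [set: alpha])
  (w_weight : weight_function w)
  (phi_orlicz : orlicz_function phi)
  (phin_orlicz : forall n, (1 <= n)%N -> orlicz_function (phi_ n))
  (phin_delta0 : forall n, (1 <= n)%N -> delta_at_zero phi (phi_ n))
  (phin_prec : forall n, (1 <= n)%N -> orlicz_prec (phi_ n.+1) (phi_ n)) :
  (([set: alpha] #<= [set: R] \/
      card_lt (order_continuous_part phi w) [set: alpha]) ->
    forall beta : Type, [set: alpha] #<= [set: beta] ->
      ~ spaceable (order_continuous_part phi w)
          (norm_open (order_continuous_part phi w) (luxemburg_norm phi w))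
          (order_continuous_part phi w `\`
             \bigcup_(n in [set n | (1 <= n)%N]) orlicz_lorentz (phi_ n) w)
          alpha beta) /\
  (delta2 phi ->
    forall beta : Type, [set: alpha] #<= [set: beta] ->
      ~ spaceable (orlicz_lorentz phi w)
          (norm_open (orlicz_lorentz phi w) (luxemburg_norm phi w))
          (orlicz_lorentz phi w `\`
             \bigcup_(n in [set n | (1 <= n)%N]) orlicz_lorentz (phi_ n) w)
          alpha beta).
Proof.
have [g gE] := unit_indicator_exists (R := R).
have ga := unit_indicator_order_continuous phi_orlicz w_weight gE.
have g0 := unit_indicator_neq0 gE.
have Yideal : order_ideal
    (\bigcup_(n in [set n | (1 <= n)%N]) orlicz_lorentz (phi_ n) w).
  apply: bigcup_order_ideal => n n1.
    exact: orlicz_lorentz_ideal (phin_orlicz n n1) w_weight.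
  apply: orlicz_lorentz_prec w_weight (phin_prec n n1).
    exact: phin_orlicz.
  exact: phin_orlicz.
have Yg : (\bigcup_(n in [set n | (1 <= n)%N]) orlicz_lorentz (phi_ n) w) g.
  exists 1%N => //.
  by case: (unit_indicator_order_continuous (phin_orlicz 1 isT) w_weight gE).
split=> _ beta _.
  have Xideal := order_continuous_part_ideal phi_orlicz w_weight.
  have XL : order_continuous_part phi w `<=` orlicz_lorentz phi w.
    by move=> f [].
  exact: (not_spaceable_order_ideal phi_orlicz w_weight Xideal Yideal XL
    ga Yg g0 alpha_inf).
have Xideal := orlicz_lorentz_ideal phi_orlicz w_weight.
exact: (not_spaceable_order_ideal phi_orlicz w_weight Xideal Yideal
  (@subset_refl _ _) ga.1 Yg g0 alpha_inf).
Qed.
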